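(* The only pair $(n,x)$ of positive integers with $n\geq 2$ satisfying $(10^{n}-2)(58^{n}-2)=x^{2}$ is $(n,x)=(2,574)$. *)

(* Defs.v *)
From Stdlib Require Import ZArith.

(* Main.v *)
(** For odd [n], the values of the left-hand side at [n] modulo 5, 7, 11 and 31
    are never all square residues.  For [n = 2 m], the two factors are [d a^2] and
    [d b^2], so [10 ^ m] and [58 ^ m] are both first coordinates of solutions
    of [X^2 - d Y^2 = 2].  If [P] is the least such coordinate, every other one
    is an odd multiple of [P]; as [P] divides both [10 ^ m] and [58 ^ m] it must
    be [2 ^ m].  The coordinates in increasing order are [P], [P (2 P^2 - 3)],
    [P (4 P^4 - 10 P^2 + 5)], ..., hence [5 ^ m = 2 * 4 ^ m - 3], which leaves
    [m = 1] and [m = 3], and [n = 6] gives no square. *)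
Require Import Defs.
From Stdlib Require Import ZArith Znumtheory Zpow_facts List Lia Classical.
Local Open Scope Z_scope.

(** * Two factors with a square product *)

Lemma square_product_common_factor (M N x : Z) (hM : 0 < M)
  (h : M * N = x ^ 2) :
  exists d a b, M = d * a ^ 2 /\ N = d * b ^ 2.
Proof.
set (g := Z.gcd M x).
assert (hg : 0 < g).
{ assert (g0 : g <> 0) by (intros e; apply Z.gcd_eq_0_l in e; lia).
  pose proof (Z.gcd_nonneg M x : 0 <= g); lia. }
destruct (Z.gcd_divide_l M x) as [a ha]; destruct (Z.gcd_divide_r M x) as [b hb].
fold g in ha, hb.
assert (hab : Z.gcd a b = 1).
{ pose proof (Z.gcd_mul_mono_r_nonneg a b g ltac:(lia)) as e.
  rewrite <- ha, <- hb in e; fold g in e; nia. }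
assert (e : a * N = g * b ^ 2).
{ apply (Z.mul_reg_l _ _ g); [lia|].
  replace (g * (a * N)) with (M * N) by (rewrite ha; ring).
  rewrite h, hb; ring. }
(* By [e], [a] divides [g b^2]; being coprime to [b] it divides [g], and [d] is the quotient. *)
assert (hag : (a | g)).
{ apply (Z.gauss a b); [|exact hab].
  apply (Z.gauss a b); [|exact hab].
  exists N; transitivity (g * b ^ 2); [ring|rewrite <- e; ring]. }
destruct hag as [d hd].
exists d, a, b; split.
- rewrite ha, hd; ring.
- apply (Z.mul_reg_l _ _ a); [intros ->; lia|]. rewrite e, hd; ring.
Qed.

(** * Positive solutions of [X^2 - d Y^2 = 2] *)

Definition pell2 (d X Y : Z) : Prop := 0 < X /\ 0 < Y /\ X ^ 2 - d * Y ^ 2 = 2.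

Lemma pell2_least (d X Y : Z) (h : pell2 d X Y) :
  exists P Q, pell2 d P Q /\ forall X' Y', pell2 d X' Y' -> P <= X'.
Proof.
(* Without a least coordinate, strong induction on [X] would rule out every solution. *)
apply NNPP; intros none.
assert (hX : 0 <= X) by (unfold pell2 in h; lia).
revert Y h; pattern X; apply Zlt_0_ind; [|exact hX].
intros X0 IH _ Y0 h0; apply none; exists X0, Y0; split; [exact h0|].
intros X' Y' h'; destruct (Z.le_gt_cases X0 X') as [|lt]; [assumption|].
unfold pell2 in h'; exfalso; apply (IH X' ltac:(lia) Y'); exact h'.
Qed.

Lemma pell2_monotone (d X Y X' Y' : Z) (hd : 0 < d) (h : pell2 d X Y)
  (h' : pell2 d X' Y') (le : X <= X') : Y <= Y'.
Proof.
unfold pell2 in *.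
apply (Z.pow_le_mono_l_iff Y Y' 2); try lia.
apply (Z.mul_le_mono_pos_l _ _ d); [lia|nia].
Qed.

Lemma lt_of_sq_lt (a b : Z) (hb : 0 <= b) (h : a ^ 2 < b ^ 2) : a < b.
Proof. nia. Qed.

(** Multiply [|Y| sqrt d < X] by [|Q| sqrt d < P]; squaring keeps the argument in the integers. *)
Lemma surd_product_pos (d X Y P Q : Z) (hd : 0 <= d) (hX : 0 < X) (hP : 0 < P)
  (h : d * Y ^ 2 < X ^ 2) (h' : d * Q ^ 2 < P ^ 2) : d * Y * Q < X * P.
Proof.
apply lt_of_sq_lt; [apply Z.mul_nonneg_nonneg; lia|].
replace ((d * Y * Q) ^ 2) with ((d * Y ^ 2) * (d * Q ^ 2)) by ring.
rewrite Z.pow_mul_l; apply Z.mul_lt_mono_nonneg;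
  try assumption; (apply Z.mul_nonneg_nonneg; [exact hd|rewrite Z.pow_2_r; apply Z.square_nonneg]).
Qed.

(* Multiplication by the inverse of the unit [(P + Q sqrt d)^2 / 2]. *)
Lemma pell2_descent (d P Q X Y : Z) (hd : 1 < d) (h : pell2 d P Q)
  (least : forall X' Y', pell2 d X' Y' -> P <= X') (hXY : pell2 d X Y)
  (lt : P < X) :
  exists X' Y', pell2 d X' Y' /\ X' < X /\
    X = (P ^ 2 - 1) * X' + d * (P * Q) * Y'.
Proof.
(* The unit is [t + s sqrt d], of norm 1, and [X' + Y' sqrt d = (X + Y sqrt d) (t - s sqrt d)].
   Halfway lies [u + v sqrt d = (X + Y sqrt d) (P - Q sqrt d)], of norm 4, whose signs are easier to
   control. *)
set (t := P ^ 2 - 1). set (s := P * Q).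
set (X' := t * X - d * s * Y). set (Y' := t * Y - s * X).
set (u := X * P - d * Y * Q). set (v := P * Y - Q * X).
unfold pell2 in h, hXY.
destruct h as (hP & hQ & e), hXY as (hX & hY & f).
assert (dQ : d * Q ^ 2 = P ^ 2 - 2) by lia.
assert (dY : d * Y ^ 2 = X ^ 2 - 2) by lia.
assert (ts : t ^ 2 - d * s ^ 2 = 1).
{ transitivity ((P ^ 2 - 1) ^ 2 - P ^ 2 * (d * Q ^ 2)); [unfold t, s; ring|].
  rewrite dQ; ring. }
assert (f' : X' ^ 2 - d * Y' ^ 2 = 2).
{ transitivity ((t ^ 2 - d * s ^ 2) * (X ^ 2 - d * Y ^ 2));
    [unfold X', Y'; ring|rewrite ts, f; reflexivity]. }
assert (back : X = t * X' + d * s * Y').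
{ transitivity ((t ^ 2 - d * s ^ 2) * X); [rewrite ts; ring|unfold X', Y'; ring]. }
assert (uv : u ^ 2 - d * v ^ 2 = 4).
{ transitivity ((P ^ 2 - d * Q ^ 2) * (X ^ 2 - d * Y ^ 2));
    [unfold u, v; ring|rewrite e, f; reflexivity]. }
assert (X'uv : 2 * X' = u * P - d * v * Q).
{ transitivity ((P ^ 2 + d * Q ^ 2) * X - 2 * d * P * Q * Y); [|unfold u, v; ring].
  rewrite dQ; unfold X', t, s; ring. }
assert (Y'uv : 2 * Y' = v * P - u * Q).
{ transitivity ((P ^ 2 + d * Q ^ 2) * Y - 2 * P * Q * X); [|unfold u, v; ring].
  rewrite dQ; unfold Y', t, s; ring. }
assert (Xuv : 2 * X = u * P + d * v * Q).
{ transitivity ((P ^ 2 - d * Q ^ 2) * X); [rewrite e; ring|unfold u, v; ring]. }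
assert (u0 : 0 < u).
{ clear - hd hX hP dQ dY; unfold u.
  apply Z.lt_0_sub, surd_product_pos; lia. }
assert (v0 : 0 < v).
{ clear - hd hY hP dQ dY lt; unfold v.
  apply Z.lt_0_sub, lt_of_sq_lt; [apply Z.mul_nonneg_nonneg; lia|].
  apply (Z.mul_lt_mono_pos_l d); [lia|].
  replace (d * (Q * X) ^ 2) with ((d * Q ^ 2) * X ^ 2) by ring.
  replace (d * (P * Y) ^ 2) with (P ^ 2 * (d * Y ^ 2)) by ring.
  (* What remains is [(P^2 - 2) X^2 < P^2 (X^2 - 2)], that is [P < X]. *)
  rewrite dY, dQ; nia. }
clearbody X' Y' u v s t.
assert (X'0 : 0 < X').
{ assert (d * v * Q < u * P); [|lia].
  clear - hd hP dQ uv u0; apply surd_product_pos; lia. }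
assert (Y'0 : 0 < Y').
{ destruct (Z.lt_trichotomy Y' 0) as [neg|[zero|pos]]; [| |exact pos].
  - (* Otherwise [(X', - Y')] would be a solution smaller than [(P, Q)]. *)
    assert (sol : pell2 d X' (- Y')).
    { repeat split; [lia|lia|]. transitivity (X' ^ 2 - d * Y' ^ 2); [ring|exact f']. }
    assert (hPQ : pell2 d P Q) by (repeat split; assumption).
    pose proof (pell2_monotone d P Q X' (- Y') ltac:(lia) hPQ sol
      (least _ _ sol)) as le.
    assert (u2 : 2 < u) by (clear - hd uv u0 v0; apply lt_of_sq_lt; nia).
    (* This is [Q <= - Y'] rewritten by [Y'uv]. Squaring, multiplying by [d] and cancelling [u - 2]
       gives [(u + 2) P^2 <= (u - 2) (P^2 - 2)], which is absurd. *)
    assert (le' : v * P <= (u - 2) * Q) by lia.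
    clear - hP hQ hd dQ uv v0 u2 le'.
    assert (sq : d * (v * P) ^ 2 <= d * ((u - 2) * Q) ^ 2).
    { apply Z.mul_le_mono_nonneg_l; [lia|].
      apply Z.pow_le_mono_l; split; [nia|exact le']. }
    replace (d * (v * P) ^ 2) with ((d * v ^ 2) * P ^ 2) in sq by ring.
    replace (d * ((u - 2) * Q) ^ 2) with ((u - 2) ^ 2 * (d * Q ^ 2)) in sq by ring.
    replace (d * v ^ 2) with ((u - 2) * (u + 2)) in sq by lia.
    rewrite dQ in sq.
    assert (sq' : (u + 2) * P ^ 2 <= (u - 2) * (P ^ 2 - 2)).
    { apply (Z.mul_le_mono_pos_l _ _ (u - 2)); [lia|].
      replace ((u - 2) * ((u + 2) * P ^ 2)) with ((u - 2) * (u + 2) * P ^ 2) by ring.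
      replace ((u - 2) * ((u - 2) * (P ^ 2 - 2)))
        with ((u - 2) ^ 2 * (P ^ 2 - 2)) by ring.
      exact sq. }
    nia.
  - rewrite zero in f'; clear - f' X'0. assert (X' <= 1 \/ 2 <= X') as [|] by lia; nia. }
exists X', Y'; repeat split; try assumption.
assert (0 < d * v * Q) by (repeat apply Z.mul_pos_pos; lia); lia.
Qed.

Lemma pell2_even (d X Y : Z) (hd : Z.Even d) (h : pell2 d X Y) : Z.Even X.
Proof.
unfold pell2 in h; destruct hd as [k ->].
destruct (Z.Even_or_Odd X) as [|[j ->]]; [assumption|exfalso; lia].
Qed.

(** Strong induction along the descent. As [d] and [P] are even, the recurrence for [X] preserves
    odd multiples of [P]. It is also monotone: it sends the least solution to the second, and any
    solution from the second on to at least the third. *)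
Lemma pell2_classification (d P Q X Y : Z) (hd : 1 < d) (even : Z.Even d)
  (h : pell2 d P Q) (least : forall X' Y', pell2 d X' Y' -> P <= X')
  (hXY : pell2 d X Y) :
  (exists k, X = P * (2 * k + 1)) /\
  (X = P \/ X = P * (2 * P ^ 2 - 3) \/ P * (4 * P ^ 4 - 10 * P ^ 2 + 5) <= X).
Proof.
assert (hX : 0 <= X) by (unfold pell2 in hXY; lia).
revert Y hXY; pattern X; apply Zlt_0_ind; [|exact hX]; clear X hX.
intros X IH _ Y hXY.
destruct (Z.eq_dec X P) as [->|ne].
{ split; [exists 0; ring|left; reflexivity]. }
pose proof (least _ _ hXY) as leX.
destruct (pell2_descent d P Q X Y hd h least hXY ltac:(lia))
  as (X' & Y' & h' & lt & e).
destruct (IH X' ltac:(unfold pell2 in h'; lia) Y' h') as [[k hk] sizes].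
pose proof (pell2_even d P Q even h) as [p hp].
destruct even as [c hc].
assert (P2 : 2 <= P) by (unfold pell2 in h; lia).
assert (P2' : 4 <= P ^ 2) by (clear - P2; nia).
assert (dQ : d * Q ^ 2 = P ^ 2 - 2) by (unfold pell2 in h; lia).
split.
{ exists (2 * p ^ 2 * (2 * k + 1) - k - 1 + c * Q * Y').
  rewrite e, hk, hc, hp; ring. }
right.
assert (next : forall X1 Y1, pell2 d X1 Y1 -> X1 <= X' ->
  (P ^ 2 - 1) * X1 + d * (P * Q) * Y1 <= X).
{ intros X1 Y1 h1 le.
  pose proof (pell2_monotone d X1 Y1 X' Y' ltac:(lia) h1 h' le).
  rewrite e; unfold pell2 in h.
  apply Z.add_le_mono; apply Z.mul_le_mono_nonneg_l;
    (assumption || lia || (repeat apply Z.mul_nonneg_nonneg; lia)). }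
(* The second solution, [(P + Q sqrt d)^3 / 2], simplified by [d Q^2 = P^2 - 2]. *)
assert (sol3 : pell2 d (P * (2 * P ^ 2 - 3)) (Q * (2 * P ^ 2 - 1))).
{ unfold pell2 in h; repeat split; [apply Z.mul_pos_pos; lia..|].
  transitivity (P ^ 2 * (2 * P ^ 2 - 3) ^ 2 - (d * Q ^ 2) * (2 * P ^ 2 - 1) ^ 2);
    [ring|rewrite dQ; ring]. }
assert (large : P * (2 * P ^ 2 - 3) <= X' ->
  P * (4 * P ^ 4 - 10 * P ^ 2 + 5) <= X).
{ intros le; pose proof (next _ _ sol3 le) as le'.
  replace (d * (P * Q) * (Q * (2 * P ^ 2 - 1)))
    with (P * (d * Q ^ 2) * (2 * P ^ 2 - 1)) in le' by ring.
  rewrite dQ in le'; etransitivity; [|exact le'].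
  apply Z.eq_le_incl; ring. }
destruct sizes as [eq|[eq|le]].
- left. assert (Y' = Q).
  { rewrite eq in h'; apply Z.le_antisymm;
      apply (pell2_monotone d P _ P); (assumption || lia). }
  subst Y'; rewrite e, eq.
  transitivity (P * (P ^ 2 - 1) + P * (d * Q ^ 2)); [ring|rewrite dQ; ring].
- right; apply large; lia.
- right; apply large; etransitivity; [|exact le].
  (* The third coordinate exceeds the second: with [z = P^2], their difference divided by [P] is
     [4 (z - 1) (z - 2)]. *)
  apply Z.mul_le_mono_nonneg_l; [lia|].
  replace (P ^ 4) with (P ^ 2 * P ^ 2) by ring.
  clear - P2'; nia.
Qed.

(** * Even exponents *)

Lemma two_mul_pow4_lt_pow5 (m : Z) (hm : 4 <= m) : 2 * 4 ^ m < 5 ^ m.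
Proof.
replace m with (4 + (m - 4)) by ring.
assert (hj : 0 <= m - 4) by lia; revert hj; generalize (m - 4); clear.
apply natlike_ind; [reflexivity|].
intros j hj IH; rewrite Z.add_succ_r, !Z.pow_succ_r by lia.
pose proof (Z.pow_pos_nonneg 4 (4 + j)); lia.
Qed.

(** The odd cofactor is coprime to [2^m], so [2^m] divides [P]; the quotient divides both [5^m] and
    [29^m], hence is 1. *)
Lemma odd_factors_of_pow (P m k l : Z) (hm : 0 <= m) (hP : 0 < P)
  (h10 : 10 ^ m = P * (2 * k + 1)) (h58 : 58 ^ m = P * (2 * l + 1)) :
  P = 2 ^ m.
Proof.
assert (pow2 : 0 < 2 ^ m) by (apply Z.pow_pos_nonneg; lia).
change 10 with (2 * 5) in h10; change 58 with (2 * 29) in h58.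
rewrite Z.pow_mul_l in h10, h58.
assert (dvd : (2 ^ m | P)).
{ apply (Gauss _ (2 * k + 1)).
  - exists (5 ^ m); rewrite Z.mul_comm, <- h10; ring.
  - apply rel_prime_sym, rel_prime_Zpower_r; [exact hm|].
    apply Zgcd_1_rel_prime.
    rewrite Z.gcd_comm, Z.add_comm, Z.mul_comm, Z.gcd_add_mult_diag_r; reflexivity. }
destruct dvd as [c ->].
assert (c5 : (c | 5 ^ m)).
{ exists (2 * k + 1); apply (Z.mul_reg_l _ _ (2 ^ m)); [lia|rewrite h10; ring]. }
assert (c29 : (c | 29 ^ m)).
{ exists (2 * l + 1); apply (Z.mul_reg_l _ _ (2 ^ m)); [lia|rewrite h58; ring]. }
assert (cop : rel_prime (5 ^ m) (29 ^ m)).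
{ apply rel_prime_Zpower; [exact hm|exact hm|].
  apply Zgcd_1_rel_prime; reflexivity. }
destruct cop as [_ _ cop].
assert (c = 1) as ->; [|ring].
apply Z.divide_1_r_nonneg; [nia|apply cop; assumption].
Qed.

Lemma even_exponent_cases (m x : Z) (hm : 1 <= m)
  (h : (10 ^ (2 * m) - 2) * (58 ^ (2 * m) - 2) = x ^ 2) : m = 1 \/ m = 3.
Proof.
replace (2 * m) with (m * 2) in h by ring.
rewrite !Z.pow_mul_r in h by lia.
assert (A10 : exists A, 0 < A /\ 10 ^ m = 2 * A).
{ exists (5 * 10 ^ (m - 1)); split.
  - pose proof (Z.pow_pos_nonneg 10 (m - 1)); lia.
  - replace m with (Z.succ (m - 1)) at 1 by lia.
    rewrite Z.pow_succ_r by lia; ring. }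
destruct A10 as (A & A0 & hA).
assert (B0 : 1 < 58 ^ m) by (apply Z.pow_gt_1; lia).
assert (M0 : 0 < (10 ^ m) ^ 2 - 2) by (rewrite hA; clear - A0; nia).
assert (N0 : 0 < (58 ^ m) ^ 2 - 2) by (clear - B0; nia).
destruct (square_product_common_factor _ _ _ M0 h)
  as (d & a & b & ha & hb).
assert (sq_abs : forall z, d * Z.abs z ^ 2 = d * z ^ 2)
  by (intros z; rewrite <- Z.pow_even_abs; [reflexivity|exists 1; reflexivity]).
assert (d0 : 0 < d) by (rewrite ha in M0; clear - M0; nia).
assert (a0 : a <> 0) by (intros ->; lia).
assert (b0 : b <> 0) by (intros ->; lia).
assert (solA : pell2 d (10 ^ m) (Z.abs a)).
{ repeat split; [lia|lia|rewrite sq_abs; lia]. }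
assert (solB : pell2 d (58 ^ m) (Z.abs b)).
{ repeat split; [lia|lia|rewrite sq_abs; lia]. }
(* [d a^2 = 4 A^2 - 2] is 2 modulo 4, whereas for odd [d] it would be odd or a multiple of 4. *)
assert (even : Z.Even d).
{ destruct (Z.Even_or_Odd d) as [|[i hi]]; [assumption|exfalso].
  rewrite hA in ha; clear - ha hi.
  destruct (Z.Even_or_Odd a) as [[j ->]|[j ->]]; subst d; lia. }
assert (d1 : 1 < d) by (destruct even; lia).
destruct (pell2_least _ _ _ solA) as (P & Q & hPQ & least).
destruct (pell2_classification _ _ _ _ _ d1 even hPQ least solA)
  as [[k hk] sizes].
destruct (pell2_classification _ _ _ _ _ d1 even hPQ least solB)
  as [[l hl] _].
assert (hP : P = 2 ^ m).
{ apply (odd_factors_of_pow P m k l); [lia|unfold pell2 in hPQ; lia|exact hk|exact hl]. }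
assert (P0 : 0 < P) by (unfold pell2 in hPQ; lia).
replace (10 ^ m) with (P * 5 ^ m) in sizes
  by (rewrite hP, <- Z.pow_mul_l; reflexivity).
assert (P2 : P ^ 2 = 4 ^ m).
{ rewrite hP, Z.pow_2_r, <- Z.pow_mul_l; reflexivity. }
assert (P4 : P ^ 4 = 4 ^ m * 4 ^ m) by (rewrite <- P2; ring).
rewrite P2, P4 in sizes.
assert (four : 4 <= 4 ^ m) by (apply (Z.pow_le_mono_r 4 1 m); lia).
assert (five : 1 < 5 ^ m) by (apply Z.pow_gt_1; lia).
destruct sizes as [eq|[eq|le]].
- assert (5 ^ m = 1) by (apply (Z.mul_reg_l _ _ P); lia). lia.
- apply Z.mul_reg_l in eq; [|lia].
  assert (m < 4) by (destruct (Z.lt_ge_cases m 4) as [|ge];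
    [assumption|pose proof (two_mul_pow4_lt_pow5 m ltac:(lia)); lia]).
  assert (m = 1 \/ m = 2 \/ m = 3) as [->|[->| ->]] by lia;
    [left; reflexivity|discriminate eq|right; reflexivity].
- apply Z.mul_le_mono_pos_l in le; [|exact P0].
  (* With [z = 4^m], [le] reads [4 z^2 - 10 z + 5 <= 5^m], which contradicts [5^m <= z^2] once
     [z >= 16]. *)
  assert (pow5 : 5 ^ m <= 4 ^ m * 4 ^ m).
  { rewrite <- Z.pow_mul_l; apply Z.pow_le_mono_l; lia. }
  destruct (Z.eq_dec m 1) as [|ne]; [left; assumption|exfalso].
  assert (pow4 : 4 ^ 2 <= 4 ^ m) by (apply Z.pow_le_mono_r; lia).
  clear - le pow5 pow4; nia.
Qed.

(** * Odd exponents: a sieve by quadratic residues *)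

Definition is_square_mod (p a : Z) : bool :=
  existsb (fun y => (Z.of_nat y ^ 2) mod p =? a mod p) (seq 0 (Z.to_nat p)).

Lemma is_square_mod_square (p a x : Z) (hp : 0 < p)
  (h : (x ^ 2) mod p = a mod p) : is_square_mod p a = true.
Proof.
pose proof (Z.mod_pos_bound x p hp).
apply existsb_exists; exists (Z.to_nat (x mod p)); split.
- apply in_seq; lia.
- rewrite Z2Nat.id by lia.
  apply Z.eqb_eq; rewrite <- h; symmetry; apply Zpower_mod; exact hp.
Qed.

(** Periodicity is taken from exponent 1 on, as [c^(k+1) = c] rather than [c^k = 1], because 10 is
    not invertible modulo 5. *)
Lemma pow_mod_period (c p k q r : Z) (hp : 0 < p) (hk : 0 <= k) (hq : 0 <= q)
  (hr : 1 <= r) (per : c ^ (k + 1) mod p = c mod p) :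
  c ^ (k * q + r) mod p = c ^ r mod p.
Proof.
revert q hq; apply natlike_ind.
- f_equal; f_equal; ring.
- intros q hq IH; rewrite <- IH.
  replace (k * Z.succ q + r) with ((k + 1) + (k * q + (r - 1))) by lia.
  replace (k * q + r) with (1 + (k * q + (r - 1))) by lia.
  rewrite (Z.pow_add_r c (k + 1)), (Z.pow_add_r c 1), Z.pow_1_r by nia.
  rewrite <- Zmult_mod_idemp_l, per, Zmult_mod_idemp_l; reflexivity.
Qed.

Lemma odd_exponent_not_square (n x : Z) (hn : 0 <= n) (odd : Z.Odd n) :
  (10 ^ n - 2) * (58 ^ n - 2) <> x ^ 2.
Proof.
intros h; destruct odd as [k hk].
set (f := fun r => (10 ^ r - 2) * (58 ^ r - 2)).
(* 60 is the least common multiple of [p - 1] for [p] = 5, 7, 11, 31, so odd exponents fall into 30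
   classes. *)
set (r := 2 * (k mod 30) + 1).
assert (hr : n = 60 * (k / 30) + r).
{ pose proof (Z.div_mod k 30 ltac:(lia)); unfold r; lia. }
assert (bound : 0 <= k mod 30 < 30) by (apply Z.mod_pos_bound; lia).
assert (residue : forall p, 0 < p -> 10 ^ (60 + 1) mod p = 10 mod p ->
  58 ^ (60 + 1) mod p = 58 mod p -> is_square_mod p (f r) = true).
{ intros p hp per10 per58; apply (is_square_mod_square p _ x hp).
  assert (hq : 0 <= k / 30) by (apply Z.div_pos; lia).
  rewrite <- h; unfold f.
  rewrite (Zmult_mod (10 ^ n - 2)), (Zmult_mod (10 ^ r - 2)).
  rewrite (Zminus_mod (10 ^ n)), (Zminus_mod (58 ^ n)).
  rewrite (Zminus_mod (10 ^ r)), (Zminus_mod (58 ^ r)).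
  rewrite hr, !(pow_mod_period _ p) by (assumption || lia); reflexivity. }
assert (sieve : forallb (fun i => let a := f (2 * Z.of_nat i + 1) in
  negb (is_square_mod 5 a && is_square_mod 7 a && is_square_mod 11 a
        && is_square_mod 31 a)) (seq 0 30) = true) by (vm_compute; reflexivity).
pose proof (proj1 (forallb_forall _ _) sieve (Z.to_nat (k mod 30))) as s.
cbv beta zeta in s; rewrite Z2Nat.id in s by lia; fold r in s.
rewrite !residue in s by reflexivity.
assert (false = true) by (apply s, in_seq; lia); discriminate.
Qed.

Theorem theorem29 (n x : Z) (hn : 2 <= n) (hx : 0 < x) :
  (10 ^ n - 2) * (58 ^ n - 2) = x ^ 2 <-> n = 2 /\ x = 574.
Proof.
split; [|intros [-> ->]; reflexivity].
intros h; destruct (Z.Even_or_Odd n) as [[m ->]|odd].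
- destruct (even_exponent_cases m x ltac:(lia) h) as [-> | ->].
  + split; [reflexivity|].
    change ((10 ^ (2 * 1) - 2) * (58 ^ (2 * 1) - 2)) with (574 ^ 2) in h.
    apply (Z.pow_inj_l 574 x 2) in h; lia.
  + exfalso.
    (* For [n = 6], [x] would be the computed integer square root, whose square misses the
       product. *)
    assert (e : Z.sqrt (x ^ 2) = x) by (rewrite Z.pow_2_r; apply Z.sqrt_square; lia).
    rewrite <- h in e; vm_compute in e; subst x; discriminate h.
- exfalso; exact (odd_exponent_not_square n x ltac:(lia) odd h).
Qed.
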